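(* Consider random linear network coding over $\mathbf{F}_q$ on a delay-free, acyclic multisource multicast network with set of sinks $T$, where $q>|T|$. Fix values of the coefficients $a_{i,j}$, $(i,j)\in K$, and $f_{i,j}$, $(i,j)\in J$, and assume that there exists a solution over $\mathbf{F}_q$ to the network connection problem with these fixed values. Let $X_1,\dots,X_\mu$ be the remaining (random) coefficients, and let $\eta$ be the number of edges $j$ for which at least one of the coefficients $a_{i,j}$, $f_{l,j}$ is random. Let $\tilde P$ be the polynomial obtained from $P=\prod_{t\in T}|M_t|$ (over $\mathbf{F}_q$) by plugging in the fixed values, let $\widehat P$ be its remainder modulo $(X_1^q-X_1,\dots,X_\mu^q-X_\mu)$, regarded as a polynomial in $X_1,\dots,X_\mu$ with coefficients that are polynomials in the $b_{t,i,j}$, and let $X_1^{j_1}\cdots X_\mu^{j_\mu}$ be its leading monomial with respect to an arbitrary monomial ordering. Then both numbers $$q^{-\mu}\prod_{v=1}^{\mu}(q-j_v)\quad\text{and}\quad q^{-\mu}\min\Big\{\prod_{i=1}^{\mu}(q-s_i)\ \Big|\ X_1^{s_1}\cdots X_\mu^{s_\mu}\text{ is in the support of }\widehat P\Big\}$$ are at least $$\left(\frac{q-|T|}{q}\right)^{\eta}.$$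
   Context: Network model. $G=(V,E)$ is a finite directed acyclic graph, possibly with parallel edges; $S\subseteq V$ is the set of sources and $T\subseteq V$ the set of sinks. The sources together generate $h$ symbols $X(1),\dots,X(h)\in\mathbf{F}_q$ per unit time, each symbol belonging to one source. Edges are identified with $1,\dots,|E|$; for an edge $j=(u,v)$, $\mathrm{tail}(j)=u$ and $\mathrm{head}(j)=v$. Matrices. $F=(f_{i,j})$ is the $|E|\times|E|$ matrix in which $f_{i,j}$ is a variable if $\mathrm{head}(i)=\mathrm{tail}(j)$ and $f_{i,j}=0$ otherwise. $A=(a_{i,j})$ is the $h\times|E|$ matrix in which $a_{i,j}$ is a variable if edge $j$ is an outgoing edge of the source sending the $i$-th symbol, and $a_{i,j}=0$ otherwise. For each $t\in T$, $B_t=(b_{t,i,j})$ is the $h\times|E|$ matrix in which $b_{t,i,j}$ is a variable if $\mathrm{head}(j)=t$ and $b_{t,i,j}=0$ otherwise. All these variables are distinct. The Edmonds matrix is $M_t=\begin{pmatrix}A&0\\ I-F&B_t^T\end{pmatrix}$, and $|M_t|$ denotes its determinant. Coding. Given values in $\mathbf{F}_q$ of all variables, edge $j$ carries $Y(j)=\sum_{i=1}^h a_{i,j}X(i)+\sum_{i:\mathrm{head}(i)=\mathrm{tail}(j)}f_{i,j}Y(i)$, and sink $t$ records $(b^{(t)}_1,\dots,b^{(t)}_h)$ with $b^{(t)}_i=\sum_{j:\mathrm{head}(j)=t}b_{t,i,j}Y(j)$. A solution to the network connection problem (over $\mathbf{F}_q$) is an assignment of values in $\mathbf{F}_q$ to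 all the variables $a_{i,j},f_{i,j},b_{t,i,j}$ such that every sink $t\in T$ can recover $(X(1),\dots,X(h))$ from $(b^{(t)}_1,\dots,b^{(t)}_h)$, whatever the symbols are. It is known that an assignment is a solution if and only if $P$ evaluates to a nonzero element of $\mathbf{F}_q$ at it. Random linear network coding. $K\subseteq\{1,\dots,h\}\times\{1,\dots,|E|\}$ and $J\subseteq\{1,\dots,|E|\}\times\{1,\dots,|E|\}$ are the index sets of coefficients $a_{i,j}$, respectively $f_{i,j}$, that are fixed in advance (they include all positions where the entry is $0$ by definition); the remaining $\mu$ coefficients $X_1,\dots,X_\mu$ among the $a_{i,j}$ and $f_{i,j}$ are the random ones. Algebra. The remainder modulo $(X_1^q-X_1,\dots,X_\mu^q-X_\mu)$ is the polynomial obtained by repeatedly replacing a factor $X_i^q$ in any term by $X_i$ until the degree in each $X_i$ is less than $q$. A monomial ordering is a total ordering $\prec$ on monomials such that $L\prec M$ implies $LN\prec MN$ and such that every nonempty set of monomials has a smallest element. The leading monomial is the $\prec$-largest monomial in the support. *)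

(* Defs.v *)
From HB Require Import structures.
From mathcomp Require Import all_boot all_order all_algebra.
From mathcomp.multinomials Require Import mpoly.

Set Implicit Arguments.
Unset Strict Implicit.
Unset Printing Implicit Defensive.

Import Order.TTheory GRing.Theory Num.Theory.
Local Open Scope ring_scope.

(* A delay-free acyclic multisource multicast network.  Edges are 'I_nedges,   *)
(* so parallel edges are allowed; [origin i] is the source sending symbol i.   *)
(* MathComp's [cycle] accepts the empty sequence, so acyclicity says that the  *)
(* only closed directed walk is the empty one.                                 *)
Record network := Network {
  vertex : finType;
  nedges : nat;
  tail : 'I_nedges -> vertex;
  head : 'I_nedges -> vertex;
  sources : {set vertex};
  sinks : {set vertex};
  nsymb : nat;
  origin : 'I_nsymb -> vertex;
  origin_source : forall i, origin i \in sources;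
  acyclic : forall s : seq vertex,
    cycle [rel u w | [exists j, (tail j == u) && (head j == w)]] s -> s = [::]
}.
Arguments tail {n} j.
Arguments head {n} j.
Arguments origin {n} i.

(* Matrix positions: [inl (i, j)] is the (i, j) entry of A, [inr (i, j)] the   *)
(* (i, j) entry of F, and (t, i, j) the (i, j) entry of B_t.                   *)
Definition cpos (N : network) : finType :=
  (('I_(nsymb N) * 'I_(nedges N)) + ('I_(nedges N) * 'I_(nedges N)))%type.
Definition bpos (N : network) : finType :=
  (vertex N * 'I_(nsymb N) * 'I_(nedges N))%type.

Definition is_cvar (N : network) (c : cpos N) : bool :=
  match c with
  | inl (i, j) => tail j == origin i
  | inr (i, j) => head i == tail j
  end.
Definition is_bvar (N : network) (p : bpos N) : bool :=
  let: (t, i, j) := p in (t \in sinks N) && (head j == t).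

Definition cvar (N : network) : finType := {c : cpos N | is_cvar c}.
Definition bvar (N : network) : finType := {p : bpos N | is_bvar p}.
Definition var (N : network) : finType := (cvar N + bvar N)%type.

Section Matrices.
Variables (N : network) (R : comNzRingType).

(* With v the indeterminates these are the matrices of the network; with v an  *)
(* assignment of scalars to the variables, their specializations.  Entries at  *)
(* positions that carry no variable are 0.                                     *)
Variable v : var N -> R.

Definition centry (c : cpos N) : R := oapp (fun x : cvar N => v (inl x)) 0 (insub c).
Definition bentry (p : bpos N) : R := oapp (fun x : bvar N => v (inr x)) 0 (insub p).

Definition Amx : 'M[R]_(nsymb N, nedges N) := \matrix_(i, j) centry (inl (i, j)).
Definition Fmx : 'M[R]_(nedges N) := \matrix_(i, j) centry (inr (i, j)).
Definition Bmx (t : vertex N) : 'M[R]_(nsymb N, nedges N) :=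
  \matrix_(i, j) bentry (t, i, j).

(* The block matrix has size (h + |E|) x (|E| + h); the cast makes its type    *)
(* that of a square matrix.                                                    *)
Definition edmonds (t : vertex N) : 'M[R]_(nsymb N + nedges N) :=
  castmx (erefl, addnC (nedges N) (nsymb N))
    (block_mx Amx 0 (1%:M - Fmx) (Bmx t)^T).

Definition edmonds_prod : R := \prod_(t in sinks N) \det (edmonds t).

End Matrices.

Section Coding.
Variables (Fq : finFieldType) (N : network) (v : var N -> Fq).

(* Since the network is acyclic, every X determines exactly one such Y.        *)
Definition carried (X : 'rV[Fq]_(nsymb N)) (Y : 'rV[Fq]_(nedges N)) : Prop :=
  forall j, Y 0 j = \sum_i Amx v i j * X 0 i
                  + \sum_(i | head i == tail j) Fmx v i j * Y 0 i.

Definition received (t : vertex N) (Y : 'rV[Fq]_(nedges N)) : 'rV[Fq]_(nsymb N) :=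
  \row_i \sum_(j | head j == t) Bmx v t i j * Y 0 j.

Definition solution : Prop :=
  forall t, t \in sinks N ->
    exists decode : 'rV[Fq]_(nsymb N) -> 'rV[Fq]_(nsymb N),
      forall X Y, carried X Y -> decode (received t Y) = X.

End Coding.

Section RandomCoding.
Variables (Fq : finFieldType) (N : network).
Variables (K : {set 'I_(nsymb N) * 'I_(nedges N)})
          (J : {set 'I_(nedges N) * 'I_(nedges N)}).

(* The fixed values; only the entries of a with index in K, and those of f     *)
(* with index in J, are used.                                                  *)
Variables (a : 'M[Fq]_(nsymb N, nedges N)) (f : 'M[Fq]_(nedges N)).

Definition agrees_with_fixed (v : var N -> Fq) : Prop :=
  (forall i j, (i, j) \in K -> Amx v i j = a i j) /\
  (forall i j, (i, j) \in J -> Fmx v i j = f i j).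

Definition random : {set cpos N} :=
  [set c | match c with inl ij => ij \notin K | inr ij => ij \notin J end].

Definition mu : nat := #|random|.

Definition eta : nat :=
  #|[set j : 'I_(nedges N) | [exists i, (i, j) \notin K]
                          || [exists l, (l, j) \notin J]]|.

Definition fixed_value (c : cpos N) : Fq :=
  match c with inl (i, j) => a i j | inr (i, j) => f i j end.

(* P in the polynomial ring over Fq in all the variables.                      *)
Definition P : {mpoly Fq[#|var N|]} :=
  edmonds_prod (fun x : var N => 'X_(enum_rank x)).

(* Polynomials in X_1, ..., X_mu over the ring of polynomials in the b_{t,i,j}. *)
Local Notation polyXb := {mpoly {mpoly Fq[#|bvar N|]}[mu]}.

(* X_k is the k-th element of the enumeration of the set of random positions.  *)
Definition plug (x : var N) : polyXb :=
  match x with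
  | inl c => if [pick k : 'I_mu | enum_val k == val c] is Some k then 'X_k
             else ((fixed_value (val c))%:MP)%:MP
  | inr b => ('X_(enum_rank b))%:MP
  end.

Definition Ptilde : polyXb :=
  mmap (fun c : Fq => (c%:MP)%:MP) (fun k => plug (enum_val k)) P.

End RandomCoding.

(* The exponent left after repeatedly replacing a factor X^q by X in X^d;      *)
(* for q >= 2, d rounds are enough to go below q.                              *)
Definition reduce_exp (q d : nat) : nat :=
  iter d (fun e => if (e < q)%N then e else (e - q + 1)%N) d.

Definition remainder (R : comNzRingType) (n q : nat) (p : {mpoly R[n]}) : {mpoly R[n]} :=
  \sum_(m <- msupp p) p@_m *: 'X_[[multinom reduce_exp q (m i) | i < n]].

Definition Phat (Fq : finFieldType) (N : network)
    (K : {set 'I_(nsymb N) * 'I_(nedges N)}) (J : {set 'I_(nedges N) * 'I_(nedges N)})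
    (a : 'M[Fq]_(nsymb N, nedges N)) (f : 'M[Fq]_(nedges N)) :=
  remainder #|Fq| (Ptilde K J a f).

Record monomial_ordering (n : nat) (prec : 'X_{1..n} -> 'X_{1..n} -> Prop) : Prop := {
  prec_irr : forall L, ~ prec L L;
  prec_trans : forall L M U, prec L M -> prec M U -> prec L U;
  prec_total : forall L M, [\/ prec L M, L = M | prec M L];
  prec_add : forall L M U, prec L M -> prec (L + U)%MM (M + U)%MM;
  prec_least : forall B : 'X_{1..n} -> Prop, (exists M, B M) ->
    exists L, B L /\ (forall M, B M -> L = M \/ prec L M)
}.

Definition leading_monomial (R : nzRingType) (n : nat)
    (prec : 'X_{1..n} -> 'X_{1..n} -> Prop) (p : {mpoly R[n]}) (L : 'X_{1..n}) : Prop :=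
  L \in msupp p /\ (forall M, M \in msupp p -> M = L \/ prec M L).

Definition mprod (n q : nat) (s : 'X_{1..n}) : rat :=
  \prod_(i < n) (q%:R - (s i)%:R).

(* The least element of a nonempty sequence of rationals (0 for [::]).         *)
Definition seq_min (s : seq rat) : rat :=
  \big[Order.min/seq.head 0 s]_(x <- s) x.

(* Main.v *)
Require Import Defs.
From mathcomp Require Import all_boot all_order all_algebra.
From mathcomp.multinomials Require Import mpoly.
From mathcomp Require Import perm ring lra.

Set Implicit Arguments.
Unset Strict Implicit.
Unset Printing Implicit Defensive.

Import Order.TTheory GRing.Theory Num.Theory.
Local Open Scope ring_scope.

(* The variables [a_(i,j)], [f_(l,j)] of a fixed edge [j] occur only in the
   column of [j] of an Edmonds matrix, and linearly.  Hence [|M_t|] has total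
   degree at most 1 in them and [P~] has total degree at most [|T| < q]; in
   particular the reduction modulo the [X_k ^ q - X_k] does nothing.  For a
   monomial of [P~] with exponents [s], grouping the factors [1 - s_k / q] by
   edge and using [prod (1 - x_k) >= 1 - sum x_k] bounds each of the [eta]
   nontrivial groups below by [1 - |T| / q].  Finally [P~] is nonzero since it
   takes a nonzero value at a solution: a left kernel vector [(x, -y)] of a
   singular [M_t] describes a transmission [y] of the message [x] that is
   received as 0, so [x = 0] by decodability and [y = 0] by acyclicity. *)

(** * Edmonds matrices under a change of values or of coefficient ring *)

Lemma eq_edmonds (N : network) (R : comNzRingType) (v w : var N -> R) t :
  v =1 w -> edmonds v t = edmonds w t.
Proof.
move=> vw; have vwA c : centry v c = centry w c.
  by rewrite /centry; case: insubP => [u _ _|_] //=.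
have vwB p : bentry v p = bentry w p.
  by rewrite /bentry; case: insubP => [u _ _|_] //=.
congr (castmx _ (block_mx _ _ (_ - _) _^T)); apply/matrixP=> i j;
  by rewrite !mxE.
Qed.

Lemma rmorph_edmonds_prod (N : network) (R S : comNzRingType)
    (g : {rmorphism R -> S}) (v : var N -> R) :
  g (edmonds_prod v) = edmonds_prod (g \o v).
Proof.
rewrite rmorph_prod; apply: eq_bigr => t _.
have gA c : g (centry v c) = centry (g \o v) c.
  by rewrite /centry; case: insubP => [u _ _|_] //=; rewrite rmorph0.
have gB p : g (bentry v p) = bentry (g \o v) p.
  by rewrite /bentry; case: insubP => [u _ _|_] //=; rewrite rmorph0.
rewrite -det_map_mx map_castmx map_block_mx map_mx0 map_mxB map_mx1 -map_trmx.
congr (\det (castmx _ (block_mx _ _ (_ - _) _^T))).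
- by apply/matrixP=> i j; rewrite !mxE; apply: gA.
- by apply/matrixP=> i j; rewrite !mxE; apply: gA.
- by apply/matrixP=> i j; rewrite !mxE; apply: gB.
Qed.

(** * Total degree in a selected set of variables *)

Section PartialDegree.
Variables (n : nat) (R : comNzRingType) (D : pred 'I_n).
Implicit Types (p q : {mpoly R[n]}) (d e : nat).

(** Bounding the support, instead of computing a degree, lets the zero polynomial satisfy every
    bound. *)
Definition pdeg_le d p : Prop :=
  forall m, m \in msupp p -> (\sum_(i | D i) m i <= d)%N.

Lemma pdeg_leW d e p : (d <= e)%N -> pdeg_le d p -> pdeg_le e p.
Proof. by move=> de dp m /dp /leq_trans; apply. Qed.

Lemma pdeg_leC c : pdeg_le 0 c%:MP.
Proof.
move=> m; rewrite msuppC; case: ifP => // _; rewrite inE => /eqP ->.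
by rewrite big1 // => i _; rewrite mnm0E.
Qed.

Lemma pdeg_le0 d : pdeg_le d 0.
Proof. by apply: (pdeg_leW (leq0n d)); rewrite -mpolyC0; apply: pdeg_leC. Qed.

Lemma pdeg_le1 d : pdeg_le d 1.
Proof. by apply: (pdeg_leW (leq0n d)); rewrite -mpolyC1; apply: pdeg_leC. Qed.

Lemma pdeg_leX i : pdeg_le (D i) 'X_i.
Proof.
move=> m; rewrite msuppX inE => /eqP ->.
rewrite (eq_bigr (fun k => (i == k : nat))) => [|k _]; last by rewrite mnm1E.
rewrite -big_mkcondr /= sum1_card.
case: (boolP (D i)) => Di; last first.
  rewrite eq_card0 // => k; rewrite !inE.
  by apply/negP=> /andP[Dk /eqP ik]; rewrite ik Dk in Di.
rewrite /= -(card1 i) subset_leq_card //.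
by apply/subsetP=> k; rewrite !inE eq_sym => /andP[].
Qed.

Lemma pdeg_leD d p q : pdeg_le d p -> pdeg_le d q -> pdeg_le d (p + q).
Proof. by move=> dp dq m /msuppD_le; rewrite mem_cat => /orP[/dp|/dq]. Qed.

Lemma pdeg_leN d p : pdeg_le d p -> pdeg_le d (- p).
Proof. by move=> dp m; rewrite (perm_mem (msuppN p)) => /dp. Qed.

Lemma pdeg_leM d e p q : pdeg_le d p -> pdeg_le e q -> pdeg_le (d + e) (p * q).
Proof.
move=> dp eq m /msuppM_le /allpairsP[[m1 m2] /= [/dp h1 /eq h2 ->]].
under eq_bigr => i _ do rewrite mnmDE.
by rewrite big_split leq_add.
Qed.

Lemma pdeg_le_sum d (I : finType) (A : pred I) (F : I -> {mpoly R[n]}) :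
  (forall i, A i -> pdeg_le d (F i)) -> pdeg_le d (\sum_(i | A i) F i).
Proof.
by move=> dF; elim/big_ind: _ => //; [exact: pdeg_le0 | exact: pdeg_leD].
Qed.

Lemma pdeg_le_prod (I : finType) (A : pred I) (d : I -> nat)
    (F : I -> {mpoly R[n]}) :
  (forall i, A i -> pdeg_le (d i) (F i)) ->
  pdeg_le (\sum_(i | A i) d i)%N (\prod_(i | A i) F i).
Proof.
move=> dF; elim/big_rec2: _ => [|i k p Ai]; first exact: pdeg_le1.
by apply: pdeg_leM; apply: dF.
Qed.

(** Each term of the Leibniz expansion takes exactly one entry from each column, so the column
    bounds add up. *)
Lemma pdeg_le_det k (d : 'I_k -> nat) (M : 'M[{mpoly R[n]}]_k) :
  (forall i j, pdeg_le (d j) (M i j)) -> pdeg_le (\sum_j d j)%N (\det M).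
Proof.
move=> dM; apply: pdeg_le_sum => s _.
have dprod : pdeg_le (\sum_j d j)%N (\prod_i M i (s i)).
  rewrite (reindex_inj (@perm_inj _ s)) /=.
  by apply: pdeg_le_prod => i _; apply: dM.
by case: (odd_perm s); rewrite ?expr1 ?expr0 ?mulN1r ?mul1r //; apply: pdeg_leN.
Qed.

End PartialDegree.

Lemma remainder_id (R : comNzRingType) n q (p : {mpoly R[n]}) :
  (forall m, m \in msupp p -> forall i, (m i < q)%N) -> remainder q p = p.
Proof.
move=> lt_q; rewrite [RHS]mpolyE /remainder.
rewrite big_seq [RHS]big_seq; apply: eq_bigr => m mp.
congr (_ *: 'X_[_]); apply/mnmP=> i; rewrite mnmE /reduce_exp.
(* Only the number of rounds is generalised: the exponent, already below [q], is fixed by each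
   round. *)
by elim: {1}(m i) => //= k ->; rewrite lt_q.
Qed.

(** * Solutions make the Edmonds matrices nonsingular *)

Section Decodability.
Variables (Fq : finFieldType) (N : network) (v : var N -> Fq).

(* Each edge carrying a nonzero symbol has a predecessor carrying a nonzero
   symbol; walking backwards one eventually closes a directed cycle. *)
Lemma carried0 (Y : 'rV[Fq]_(nedges N)) : carried v 0 Y -> Y = 0.
Proof.
move=> cY; apply/rowP=> j0; rewrite mxE; apply/eqP/negPn/negP=> Yj0.
pose g j := odflt j [pick i | (Defs.head i == tail j) && (Y 0 i != 0)].
have gP j : Y 0 j != 0 -> (Defs.head (g j) == tail j) && (Y 0 (g j) != 0).
  move=> Yj; rewrite /g; case: pickP => //= noi; case/eqP: Yj.
  rewrite cY big1 => [|i _]; last by rewrite [X in _ * X]mxE mulr0.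
  rewrite add0r big1 // => i hi; move: (noi i); rewrite hi /= => /negbFE/eqP ->.
  by rewrite mulr0.
have Yg k j : Y 0 j != 0 -> Y 0 (iter k g j) != 0.
  by move=> Yj; elim: k => //= k /gP /andP[].
(* There are finitely many edges, so the backward walk from [j0] returns to an edge [x] visited
   before. *)
have /trajectP[i lti Ei] := looping_order g j0.
set x := iter i g j0 in Ei.
have Yx : Y 0 x != 0 by apply: Yg.
have [k Ek] : exists k, iter k.+1 g x = x.
  by exists (fingraph.order g j0 - i).-1; rewrite prednK ?subn_gt0 // -iterD subnK // ltnW.
pose s := [seq tail j | j <- traject g x k.+1].
suff /acyclic : cycle [rel u w | [exists j, (tail j == u) && (Defs.head j == w)]] (rev s).
  by move/(congr1 size); rewrite size_rev size_map size_traject.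
rewrite rev_cycle /s /= -map_rcons path_map.
have -> : rcons (traject g (g x) k) x = traject g (g x) k.+1.
  by rewrite trajectSr -iterSr Ek.
elim: k.+1 (x) Yx => //= k' IH z /gP /andP[hz Ygz].
by rewrite IH // andbT; apply/existsP; exists (g z); rewrite eqxx.
Qed.

Lemma mulmx_carried (x : 'rV[Fq]_(nsymb N)) (y : 'rV[Fq]_(nedges N)) :
  y *m (1%:M - Fmx v) = x *m Amx v -> carried v x y.
Proof.
rewrite mulmxBr mulmx1 => /eqP; rewrite subr_eq => /eqP Ey j.
rewrite {1}Ey !mxE; congr (_ + _); first by apply: eq_bigr => i _; rewrite mulrC.
rewrite [RHS]big_mkcond; apply: eq_bigr => i _; rewrite mulrC.
by case: ifP => // hij; rewrite mxE /centry insubF ?mul0r //= hij.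
Qed.

Lemma received_mulmx t (y : 'rV[Fq]_(nedges N)) :
  received v t y = y *m (Bmx v t)^T.
Proof.
apply/rowP=> i; rewrite !mxE big_mkcond; apply: eq_bigr => j _.
rewrite mulrC !mxE; case: ifP => // hj.
by rewrite /bentry insubF ?mulr0 //= hj andbF.
Qed.

Lemma solution_det_edmonds t :
  solution v -> t \in sinks N -> \det (edmonds v t) != 0.
Proof.
move=> sol /sol [decode dec]; apply/negP=> /det0P[w wn0 /eqP].
rewrite -[w]hsubmxK in wn0 *; set x := lsubmx w in wn0 *; set y := rsubmx w in wn0 *.
(* The cast in [edmonds] only retypes the columns, so it does not affect the left kernel. *)
have castP k n n' (e : n = n') (u : 'rV[Fq]_k) (M : 'M[Fq]_(k, n)) :
    (u *m castmx (erefl, e) M == 0) = (u *m M == 0).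
  by case: n' / e; rewrite castmx_id.
rewrite castP mul_row_block mulmx0 add0r -row_mx0 => /eqP/eq_row_mx[xy yB].
have cxy : carried v x (- y).
  by apply: mulmx_carried; rewrite mulNmx; apply/eqP; rewrite eq_sym -addr_eq0 xy.
(* The zero message is also received as 0, so the decoder must return the same message for both. *)
have c00 : carried v 0 0 by apply: mulmx_carried; rewrite !mul0mx.
have x0 : x = 0.
  rewrite -(dec _ _ cxy) -[RHS](dec _ _ c00) !received_mulmx.
  by rewrite mulNmx yB oppr0 mul0mx.
rewrite x0 in cxy wn0; move/carried0/eqP: cxy; rewrite oppr_eq0 => /eqP y0.
by rewrite y0 row_mx0 eqxx in wn0.
Qed.

End Decodability.

(** * Nonvanishing and degree of [Ptilde] *)

Section Ptilde.
Variables (Fq : finFieldType) (N : network).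
Variables (K : {set 'I_(nsymb N) * 'I_(nedges N)})
          (J : {set 'I_(nedges N) * 'I_(nedges N)}).
Variables (a : 'M[Fq]_(nsymb N, nedges N)) (f : 'M[Fq]_(nedges N)).

(** Plugging in values is a ring morphism, so it passes through the product and the determinants to
    the matrix entries. *)
Lemma Ptilde_edmonds_prod : Ptilde K J a f = edmonds_prod (plug K J a f).
Proof.
pose h : {rmorphism Fq -> {mpoly {mpoly Fq[#|bvar N|]}[mu K J]}} :=
  @mpolyC _ _ \o @mpolyC _ _.
pose g : {rmorphism {mpoly Fq[#|var N|]} -> {mpoly {mpoly Fq[#|bvar N|]}[mu K J]}} :=
  mmap h (fun k => plug K J a f (enum_val k)).
have -> : Ptilde K J a f = g (P Fq N) by [].
rewrite rmorph_edmonds_prod /edmonds_prod; apply: eq_bigr => t _.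
congr (\det _); apply: eq_edmonds => x /=.
by rewrite mmapX mmap1U enum_rankK.
Qed.

Lemma Ptilde_neq0 v :
  solution v -> agrees_with_fixed K J a f v -> Ptilde K J a f != 0.
Proof.
move=> sol [agA agF].
(* Evaluation at [v] in two stages: [h] treats the b-variables in the coefficients, [g] then the
   random variables. *)
pose h : {rmorphism {mpoly Fq[#|bvar N|]} -> Fq} :=
  meval (fun k => v (inr (enum_val k))).
pose g : {rmorphism {mpoly {mpoly Fq[#|bvar N|]}[mu K J]} -> Fq} :=
  mmap h (fun k => centry v (enum_val k)).
have gplug x : g (plug K J a f x) = v x.
  case: x => [c|b] /=; last by rewrite mmapC /= mevalXU enum_rankK.
  have centryE : centry v (sval c) = v (inl c).
    by rewrite /centry -[sval c]/(val c) valK.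
  case: pickP => [k /eqP Ek|noc] /=.
    by rewrite mmapX mmap1U Ek.
  rewrite mmapC /= mevalC -centryE.
  (* A random position would be enumerated by some [k], against [noc]; hence the position is fixed
     and [v] has the prescribed value there. *)
  have : sval c \notin random K J.
    apply/negP=> rc; have := noc (enum_rank_in rc (sval c)).
    by rewrite enum_rankK_in ?eqxx.
  case: (sval c) => [[i j]|[i j]]; rewrite inE negbK /= => ij.
    by rewrite -agA // mxE.
  by rewrite -agF // mxE.
apply/negP=> /eqP P0; have := congr1 g P0.
rewrite Ptilde_edmonds_prod rmorph_edmonds_prod rmorph0 => /eqP.
apply/negP/prodf_neq0 => t tT.
by rewrite (eq_edmonds t gplug); apply: solution_det_edmonds.
Qed.

Definition pos_edge (c : cpos N) : 'I_(nedges N) :=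
  match c with inl ij => ij.2 | inr ij => ij.2 end.

Definition var_edge (k : 'I_(mu K J)) : 'I_(nedges N) := pos_edge (enum_val k).

Lemma pdeg_centry_plug j c :
  pdeg_le (fun k => var_edge k == j) (pos_edge c == j) (centry (plug K J a f) c).
Proof.
rewrite /centry; case: insubP => [u _ <-|_] /=; last exact: pdeg_le0.
case: pickP => [k /eqP Ek|_]; last by apply: (pdeg_leW (leq0n _)); apply: pdeg_leC.
by rewrite -Ek; apply: (@pdeg_leX _ _ (fun k => var_edge k == j)).
Qed.

Lemma pdeg_Ptilde j :
  pdeg_le (fun k => var_edge k == j) #|sinks N| (Ptilde K J a f).
Proof.
rewrite Ptilde_edmonds_prod -sum1_card; apply: pdeg_le_prod => t _.
(* Each sink should contribute degree at most 1. The edge columns come first in the block matrix, so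
   column [j] is the one of numerical index [j]; every other column gets weight 0. *)
pose d (k : 'I_(nsymb N + nedges N)) : nat := (j == k :> nat).
have d1 : (\sum_k d k <= 1)%N.
  rewrite -big_mkcond sum1_card; apply/card_le1_eqP => k k'.
  by move=> /eqP jk /eqP jk'; apply: val_inj; rewrite /= -jk.
apply: (pdeg_leW d1); apply: pdeg_le_det => i k.
rewrite castmxE cast_ord_id.
set k0 := cast_ord _ k; have -> : d k = (j == k0 :> nat) by [].
case: (split_ordP k0) => k' ->; case: (split_ordP i) => i' ->;
  rewrite ?block_mxEul ?block_mxEur ?block_mxEdl ?block_mxEdr /= !mxE.
- by rewrite eq_sym; apply: pdeg_centry_plug.
- apply: pdeg_leD.
    by rewrite mulrb; case: ifP => _; [apply: pdeg_le1 | apply: pdeg_le0].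
  by apply: pdeg_leN; rewrite eq_sym; apply: pdeg_centry_plug.
- exact: pdeg_le0.
- rewrite /bentry; case: insubP => [u _ _|_] /=; last exact: pdeg_le0.
  by apply: (pdeg_leW (leq0n _)); apply: pdeg_leC.
Qed.

End Ptilde.

(** * Lower bound for the product, edge by edge *)

Lemma prod_onem_ge (R : realFieldType) (I : finType) (A : pred I) (x : I -> R) :
  (forall i, A i -> 0 <= x i <= 1) ->
  1 - \sum_(i | A i) x i <= \prod_(i | A i) (1 - x i).
Proof.
move=> x01.
(* The induction also needs the product to stay in [0, 1]. *)
suff [] : 1 - \sum_(i | A i) x i <= \prod_(i | A i) (1 - x i)
       /\ 0 <= \prod_(i | A i) (1 - x i) <= 1 by [].
elim/big_rec2: _ => [|i p s Ai [IH /andP[p0 p1]]]; first by rewrite subr0 lexx ler01.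
by have /andP[xi0 xi1] := x01 i Ai; split; [nra | apply/andP; split; nra].
Qed.

(** Identifies [eta] with the number of nonempty groups when the random variables are grouped by
    edge. *)
Lemma eta_var_edge (N : network) (K : {set 'I_(nsymb N) * 'I_(nedges N)})
    (J : {set 'I_(nedges N) * 'I_(nedges N)}) :
  eta K J = #|[pred j | [exists k : 'I_(mu K J), var_edge k == j]]|.
Proof.
apply: eq_card => j; rewrite !inE; apply/idP/existsP.
  case/orP=> /existsP[i ij].
    have rc : inl (i, j) \in random K J by rewrite inE.
    by exists (enum_rank_in rc (inl (i, j))); rewrite /var_edge enum_rankK_in.
  have rc : inr (i, j) \in random K J by rewrite inE.
  by exists (enum_rank_in rc (inr (i, j))); rewrite /var_edge enum_rankK_in.
case=> k; rewrite /var_edge; have := enum_valP k.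
case: (enum_val k) => [[i j']|[i j']]; rewrite inE /= => ij /eqP <-; apply/orP.
  by left; apply/existsP; exists i.
by right; apply/existsP; exists i.
Qed.

Lemma mprod_ge (N : network) (K : {set 'I_(nsymb N) * 'I_(nedges N)})
    (J : {set 'I_(nedges N) * 'I_(nedges N)}) (q T : nat) (s : 'X_{1..mu K J}) :
  (T < q)%N ->
  (forall j, \sum_(k | var_edge k == j) s k <= T)%N ->
  ((q%:R - T%:R) / q%:R) ^+ eta K J <= q%:R ^- mu K J * mprod q s.
Proof.
move=> Tq sT; have q0 : 0 < q%:R :> rat by rewrite ltr0n (leq_ltn_trans _ Tq).
have sk k : (s k <= T)%N.
  by apply: leq_trans (sT (var_edge k)); rewrite (bigD1 k) //= leq_addr.
have -> : q%:R ^- mu K J * mprod q s = \prod_k (1 - (s k)%:R / q%:R).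
  rewrite -exprVn -[X in _ ^+ X]card_ord -prodr_const -big_split.
  by apply: eq_bigr => k _ /=; field; rewrite gt_eqF.
rewrite (partition_big (@var_edge N K J) xpredT) //= eta_var_edge -prodr_const.
(* Both sides become products over all edges; an edge without random coefficients contributes 1 to
   each. *)
rewrite big_mkcond; apply: ler_prod => j _.
case: ifP => [_|/negbT]; last first.
  rewrite inE negb_exists => /forallP nok.
  by rewrite big_pred0 ?ler01 ?lexx // => k; apply/negbTE.
apply/andP; split.
  by rewrite divr_ge0 ?subr_ge0 ?ler_nat ?(ltW q0) ?(ltnW Tq).
apply: le_trans (prod_onem_ge _) => [|k _]; last first.
  by rewrite divr_ge0 ?ler0n //= ler_pdivrMr // mul1r ler_nat (leq_trans (sk k)) // ltnW.
rewrite -mulr_suml -natr_sum mulrBl divff ?gt_eqF // lerD2l lerN2.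
by rewrite ler_pM2r ?invr_gt0 // ler_nat.
Qed.

(** * Leading monomial, minimum over the support, and conclusion *)

Lemma leading_monomialP (R : nzRingType) n (p : {mpoly R[n]})
    (prec : 'X_{1..n} -> 'X_{1..n} -> Prop) :
  monomial_ordering prec -> p != 0 -> exists L, leading_monomial prec p L.
Proof.
move=> [_ trans total _ _]; rewrite -msupp_eq0 /leading_monomial.
elim: (msupp p) => // m [|m' r] IH _.
  by exists m; split=> [|M]; rewrite inE // => /eqP; left.
have [L [Ls Lmax]] := IH isT.
have [mL|mL|Lm] := total m L.
- exists L; split=> [|M]; first by rewrite inE Ls orbT.
  by rewrite in_cons => /orP[/eqP ->|/Lmax]; [right|].
- exists L; split=> [|M]; first by rewrite inE Ls orbT.
  by rewrite in_cons => /orP[/eqP ->|/Lmax]; [left|].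
- exists m; split=> [|M]; first by rewrite inE eqxx.
  rewrite in_cons => /orP[/eqP ->|/Lmax]; first by left.
  by case=> [->|ML]; right=> //; apply: trans ML Lm.
Qed.

(** The fold starts from the head of the list, itself a member, and a minimum of two members is a
    member. *)
Lemma seq_min_mem (s : seq rat) : s != [::] -> seq_min s \in s.
Proof.
case: s => // x s _; rewrite /seq_min /= big_seq.
elim/big_ind: _ => [|y z ys zs|//]; first exact: mem_head.
by rewrite minEle; case: ifP.
Qed.

Theorem mainTheorem4 (Fq : finFieldType) (N : network)
    (K : {set 'I_(nsymb N) * 'I_(nedges N)})
    (J : {set 'I_(nedges N) * 'I_(nedges N)})
    (a : 'M[Fq]_(nsymb N, nedges N)) (f : 'M[Fq]_(nedges N))
    (prec : 'X_{1..mu K J} -> 'X_{1..mu K J} -> Prop) :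
  (#|sinks N| < #|Fq|)%N ->
  (forall i j, ~~ is_cvar (inl (i, j)) -> (i, j) \in K) ->
  (forall i j, ~~ is_cvar (inr (i, j)) -> (i, j) \in J) ->
  (exists v : var N -> Fq, solution v /\ agrees_with_fixed K J a f v) ->
  monomial_ordering prec ->
  let q := #|Fq| in
  let bound : rat := ((q%:R - #|sinks N|%:R) / q%:R) ^+ eta K J in
  exists L : 'X_{1..mu K J},
    [/\ leading_monomial prec (Phat K J a f) L,
        bound <= q%:R ^- mu K J * mprod q L
      & bound <= q%:R ^- mu K J
                 * seq_min [seq mprod q s | s <- msupp (Phat K J a f)]].
Proof.
move=> Tq _ _ [v [sol ag]] ord_prec q bound.
have Pdeg s : s \in msupp (Ptilde K J a f) ->
    forall j, (\sum_(k | var_edge k == j) s k <= #|sinks N|)%N.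
  by move=> sP j; apply: pdeg_Ptilde sP.
have PhatE : Phat K J a f = Ptilde K J a f.
  apply: remainder_id => s /Pdeg sT i; apply: leq_ltn_trans Tq.
  by apply: leq_trans (sT (var_edge i)); rewrite (bigD1 i) //= leq_addr.
have P0 := Ptilde_neq0 sol ag; rewrite PhatE.
have ge_bound s : s \in msupp (Ptilde K J a f) -> bound <= q%:R ^- mu K J * mprod q s.
  by move=> /Pdeg; apply: mprod_ge.
have [L LP] := leading_monomialP ord_prec P0.
exists L; split=> //; first by apply: ge_bound; case: LP.
(* The minimum is attained at some monomial of the support, so the bound for single monomials
   applies. *)
set r := map _ _; have : seq_min r \in r.
  by apply: seq_min_mem; rewrite -size_eq0 size_map size_eq0 msupp_eq0.
by case/mapP=> s sP ->; apply: ge_bound.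
Qed.
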